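(* Let $G_1$ and $G_2$ be simple unweighted graphs with the same number of vertices. Then the graph join $G_1\vee G_2$ is exact. In particular, for every simple unweighted graph $G$, the join $G\vee G$ (of two disjoint copies of $G$) is exact. Moreover, $G\vee G$ admits a unique optimal MAXCUT SDP solution if the complement graph $G^c$ is connected.
   Context: All graphs are finite, nonempty, simple and unweighted (every edge has weight $1$). The graph join of disjoint graphs $G_1=(V_1,E_1)$ and $G_2=(V_2,E_2)$ is $G_1\vee G_2=(V_1\cup V_2,\ E_1\cup E_2\cup\{(u,v): u\in V_1, v\in V_2\})$. The Laplacian $\mathcal{L}_G$ of a graph $G=(V,E)$ with edge weights $w_{ij}$ ($w_{ij}=0$ for non-edges) is the $V\times V$ matrix with off-diagonal entries $-w_{ij}$ and diagonal entries $\sum_{j\ne i}w_{ij}$. The MAXCUT SDP of $G$ is: maximize $\frac14\langle \mathcal{L}_G,\mathbf{X}\rangle$ over symmetric matrices $\mathbf{X}\in\mathbb{R}^{V\times V}$ with $X_{ii}=1$ for all $i\in V$ and $\mathbf{X}\succeq \mathbf{0}$, where $\langle \mathbf{A},\mathbf{B}\rangle=\operatorname{tr}(\mathbf{A}\mathbf{B})$. $\mathrm{MAXCUT}(G)$ is the maximum, over partitions $(S,V\setminus S)$ of $V$, of the total weight of edges with exactly one endpoint in $S$. $G$ is called exact if the optimal value of the MAXCUT SDP of $G$ equals $\mathrm{MAXCUT}(G)$; equivalently, if the MAXCUT SDP has an optimal solution of rank $1$. *)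

(* Defs.v *)
From mathcomp Require Import all_boot all_order all_algebra.
From mathcomp Require Import classical_sets reals.

Set Implicit Arguments.
Unset Strict Implicit.
Unset Printing Implicit Defensive.

Import Order.TTheory GRing.Theory Num.Theory.
Local Open Scope ring_scope.

Record sgraph : Type := SGraph {
  vertex : finType;
  adj : rel vertex;
  adj_sym : symmetric adj;
  adj_irr : irreflexive adj;
  vertex_nonempty : (0 < #|vertex|)%N
}.

Definition join_adj (G1 G2 : sgraph) : rel (vertex G1 + vertex G2)%type :=
  fun x y =>
    match x, y with
    | inl u, inl v => adj u v
    | inr u, inr v => adj u v
    | _, _ => true
    end.

Lemma join_adj_sym (G1 G2 : sgraph) : symmetric (@join_adj G1 G2).
Proof. by move=> [u|u] [v|v] //=; rewrite adj_sym. Qed.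

Lemma join_adj_irr (G1 G2 : sgraph) : irreflexive (@join_adj G1 G2).
Proof. by move=> [u|u] /=; rewrite adj_irr. Qed.

Lemma join_nonempty (G1 G2 : sgraph) :
  (0 < #|{: vertex G1 + vertex G2}|)%N.
Proof. by rewrite card_sum addn_gt0 vertex_nonempty. Qed.

(* The vertex set is the disjoint sum, so [graph_join G G] joins two disjoint
   copies of [G]. *)
Definition graph_join (G1 G2 : sgraph) : sgraph :=
  SGraph (@join_adj_sym G1 G2) (@join_adj_irr G1 G2) (join_nonempty G1 G2).

Definition compl_adj (G : sgraph) : rel (vertex G) :=
  fun u v => (u != v) && ~~ adj u v.

Lemma compl_adj_sym (G : sgraph) : symmetric (@compl_adj G).
Proof. by move=> u v; rewrite /compl_adj eq_sym adj_sym. Qed.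

Lemma compl_adj_irr (G : sgraph) : irreflexive (@compl_adj G).
Proof. by move=> u; rewrite /compl_adj eqxx. Qed.

Definition graph_compl (G : sgraph) : sgraph :=
  SGraph (@compl_adj_sym G) (@compl_adj_irr G) (vertex_nonempty G).

Definition graph_connected (G : sgraph) : Prop :=
  forall u v : vertex G, connect (@adj G) u v.

Definition unit_weight (R : realType) (G : sgraph) : vertex G -> vertex G -> R :=
  fun u v => (adj u v)%:R.

(* V x V matrices are represented in ['M_#|V|], the vertex attached to index
   [i] being [enum_val i]. *)
Definition laplacian (R : realType) (V : finType) (w : V -> V -> R) :
    'M[R]_#|V| :=
  \matrix_(i, j)
    if i == j then \sum_(v : V | v != enum_val i) w (enum_val i) v
    else - w (enum_val i) (enum_val j).

Definition psd (R : realType) (n : nat) (X : 'M[R]_n) : Prop :=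
  X^T = X /\ forall x : 'cV[R]_n, 0 <= (x^T *m X *m x) ord0 ord0.

Definition sdp_feasible (R : realType) (n : nat) (X : 'M[R]_n) : Prop :=
  (forall i, X i i = 1) /\ psd X.

Definition sdp_objective (R : realType) (V : finType) (w : V -> V -> R)
    (X : 'M[R]_#|V|) : R :=
  4%:R^-1 * \tr (laplacian w *m X).

Definition sdp_values (R : realType) (V : finType) (w : V -> V -> R) : set R :=
  [set sdp_objective w X | X in [set X | sdp_feasible X]]%classic.

(* The supremum of a set of reals defaults to 0 outside [has_sup]; see
   [has_sup_sdp_values]. *)
Definition sdp_value (R : realType) (V : finType) (w : V -> V -> R) : R :=
  sup (sdp_values w).

Definition sdp_optimal (R : realType) (V : finType) (w : V -> V -> R)
    (X : 'M[R]_#|V|) : Prop :=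
  sdp_feasible X /\
  forall Y : 'M[R]_#|V|,
    sdp_feasible Y -> sdp_objective w Y <= sdp_objective w X.

Definition cut_weight (R : realType) (V : finType) (w : V -> V -> R)
    (S : {set V}) : R :=
  \sum_(u in S) \sum_(v in ~: S) w u v.

(* The default value 0 is the weight of the cut [S = set0]. *)
Definition maxcut (R : realType) (V : finType) (w : V -> V -> R) : R :=
  \big[Order.max/0]_(S : {set V}) cut_weight w S.

Definition sdp_exact (R : realType) (G : sgraph) : Prop :=
  sdp_value (@unit_weight R G) = maxcut (@unit_weight R G).

Lemma quad_form_delta (R : realType) (n : nat) (X : 'M[R]_n) (i j : 'I_n)
    (c : R) :
  let x : 'cV[R]_n := delta_mx i ord0 + c *: delta_mx j ord0 in
  (x^T *m X *m x) ord0 ord0 =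
  X i i + c * X i j + (c * X j i + c * (c * X j j)).
Proof.
have E k l : (delta_mx k ord0)^T *m X *m delta_mx l (ord0 : 'I_1)
             = (X k l)%:M :> 'M[R]_1.
  rewrite trmx_delta -rowE -colE.
  by apply/matrixP=> a b; rewrite !ord1 !mxE eqxx mulr1n.
move=> x; have -> : x^T = (delta_mx i ord0)^T + c *: (delta_mx j ord0)^T.
  by rewrite /x linearD linearZ.
rewrite /x mulmxDl !mulmxDr !mulmxDl.
rewrite -!scalemxAl -!scalemxAr !E !mxE /= !mulr1n.
by rewrite addrACA addrA -!addrA; congr (_ + _); rewrite addrCA.
Qed.

Lemma sdp_feasible_norm_le1 (R : realType) (n : nat) (X : 'M[R]_n)
    (i j : 'I_n) : sdp_feasible X -> `|X i j| <= 1.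
Proof.
move=> [diagX [symX posX]].
have Xji : X j i = X i j by rewrite -[in LHS]symX mxE.
have two k : 0 <= 1 + k + (k + 1) -> -1 <= k :> R.
  rewrite [k + 1]addrC -mulr2n pmulrn_lge0 //.
  by rewrite -lerBlDl sub0r.
have := posX (delta_mx i ord0 + 1 *: delta_mx j ord0).
rewrite quad_form_delta !diagX Xji !mul1r => /two h1.
have := posX (delta_mx i ord0 + (-1) *: delta_mx j ord0).
rewrite quad_form_delta !diagX Xji !mulN1r opprK => /two h2.
by rewrite ler_norml h1 /= -lerN2.
Qed.

Lemma has_sup_sdp_values (R : realType) (V : finType) (w : V -> V -> R) :
  has_sup (sdp_values w).
Proof.
split.
  exists (sdp_objective w 1%:M), 1%:M => //; split=> [i|].
    by rewrite mxE eqxx.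
  split; first by rewrite trmx1.
  move=> x; rewrite mulmx1 mxE; apply: sumr_ge0 => k _.
  by rewrite mxE -expr2 sqr_ge0.
exists (4%:R^-1 * \sum_i \sum_k `|laplacian w i k|) => _ [X feasX <-].
rewrite /sdp_objective ler_wpM2l ?invr_ge0 ?ler0n //.
apply: ler_sum => i _; rewrite mxE; apply: ler_sum => k _.
apply: le_trans (ler_norm _) _; rewrite normrM ler_piMr //.
exact: sdp_feasible_norm_le1.
Qed.

(* Main.v *)
Require Import Defs.
From mathcomp Require Import all_boot all_order all_algebra.
From mathcomp Require Import reals.
From mathcomp Require Import ring lra.

(** Write [N] for the number of vertices.  All edge weights are at most [1], so
    the graph is dominated by the complete graph: for a feasible [X] all numbers
    [1 - X u v] are nonnegative.  Precisely,
      [4 * objective = N ^ 2 - (sum of the entries of X)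
                       - \sum_(u, v) (1 - w u v) * (1 - X u v)]
    ([sdp_objective_slack]), and both subtracted terms are nonnegative, the
    first because it is the quadratic form of [X] at the all-ones vector.
    The SDP value is therefore at most [N ^ 2 / 4].  A join of two graphs of
    the same size [n] has [N = 2 * n], and separating the two sides cuts
    [n * n = N ^ 2 / 4] edges; since cuts are feasible points of the SDP
    ([sdp_objective_cut_mx]), both optima equal [N ^ 2 / 4]
    ([balanced_cut_exact]).

    For uniqueness, an optimal [X] makes both subtracted terms vanish
    ([sdp_optimal_tight]): its entries sum to [0] and [X u v = 1] on every
    non-edge.  Seen as a Gram matrix of unit vectors, [X u v = 1] forces the
    vectors of [u] and [v] to coincide ([psd_row_eq]).  When the complements are
    connected, all vectors on one side of the join are thus equal, so [X] is [1]
    on the diagonal blocks and a constant [c] on the off-diagonal ones; the zero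
    sum gives [c = -1], which is the matrix of the separating cut. *)

Set Implicit Arguments.
Unset Strict Implicit.
Unset Printing Implicit Defensive.

Import Order.TTheory GRing.Theory Num.Theory.
Local Open Scope ring_scope.

(** * Rows of positive semidefinite matrices *)

Definition entry (R : realType) (V : finType) (X : 'M[R]_#|V|) (u v : V) : R :=
  X (enum_rank u) (enum_rank v).

Lemma sum_enum_rank (R : realType) (V : finType) (F : 'I_#|V| -> R) :
  \sum_i F i = \sum_(u : V) F (enum_rank u).
Proof. by rewrite (reindex enum_rank) //; apply/onW_bij/enum_rank_bij. Qed.

Lemma quad_formE (R : realType) (n : nat) (X : 'M[R]_n) (x : 'cV[R]_n) :
  (x^T *m X *m x) ord0 ord0 = \sum_i \sum_j x i ord0 * X i j * x j ord0.
Proof.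
rewrite mxE exchange_big /=; apply: eq_bigr => j _.
by rewrite mxE mulr_suml; apply: eq_bigr => i _; rewrite mxE.
Qed.

(** Testing positivity at [e_i - e_j + t e_k] gives [t ^ 2 + 2 t d >= 0] with
    [d = X i k - X j k]; the choice [t = - d] leaves [- d ^ 2 >= 0]. *)
Lemma psd_row_eq (R : realType) (n : nat) (X : 'M[R]_n) (i j k : 'I_n) :
  sdp_feasible X -> X i j = 1 -> X i k = X j k.
Proof.
move=> [diagX [symX posX]] Xij.
have sX a b : X a b = X b a by rewrite -[in LHS]symX mxE.
pose t : R := X j k - X i k.
pose x : 'cV[R]_n :=
  delta_mx i ord0 + (-1) *: delta_mx j ord0 + t *: delta_mx k ord0.
have := posX x.
have E a b : (delta_mx a ord0)^T *m X *m delta_mx b (ord0 : 'I_1)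
             = (X a b)%:M :> 'M[R]_1.
  rewrite trmx_delta -rowE -colE.
  by apply/matrixP=> p q; rewrite !ord1 !mxE eqxx mulr1n.
have -> : x^T = (delta_mx i ord0)^T + (-1) *: (delta_mx j ord0)^T
                + t *: (delta_mx k ord0)^T by rewrite /x !linearD !linearZ.
rewrite /x !(mulmxDl, mulmxDr).
rewrite -!(scalemxAl, scalemxAr) !E !mxE /= !mulr1n !diagX (sX j i) (sX k i).
rewrite (sX k j) Xij => h.
apply/eqP; rewrite eq_sym -subr_eq0 -/t -sqrf_eq0 eq_le sqr_ge0 andbT.
by move: h; rewrite /t; nra.
Qed.

(** Equality of rows is transitive, so it propagates along paths of the
    complement.  In a join each side is only a part of the vertices; [h] embeds
    that side into the indices of [X]. *)
Lemma connected_row_eq (R : realType) (G : sgraph) (n : nat)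
    (h : vertex G -> 'I_n) (X : 'M[R]_n) :
  sdp_feasible X -> graph_connected (graph_compl G) ->
  (forall u v, compl_adj u v -> X (h u) (h v) = 1) ->
  forall u v k, X (h u) k = X (h v) k.
Proof.
move=> fX connG adj1 u v k.
have /connectP[p] := connG u v.
elim: p u => [|z p IHp] u /= => [_ -> //|/andP[uz zp] vE].
rewrite -(IHp _ zp vE); apply: psd_row_eq fX _; exact: adj1.
Qed.

(** * Upper bound on the SDP and feasibility of cuts *)

Section Objective.
Variables (R : realType) (V : finType) (w : V -> V -> R).
Implicit Types (X : 'M[R]_#|V|) (S : {set V}).

Lemma sdp_objectiveE X : sdp_feasible X ->
  sdp_objective w X = 4^-1 * \sum_u \sum_v w u v * (1 - entry X u v).
Proof.
move=> [diagX [symX _]]; congr (_ * _).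
rewrite /mxtrace sum_enum_rank; apply: eq_bigr => u _.
rewrite mxE sum_enum_rank (bigD1 u) //= !mxE eqxx diagX mulr1 enum_rankK.
rewrite [RHS](bigD1 u) //= /entry diagX subrr mulr0 add0r -big_split /=.
apply: eq_bigr => v vu; rewrite !mxE (inj_eq enum_rank_inj) eq_sym (negPf vu).
by rewrite !enum_rankK -[in X in _ - X](symX) mxE mulrBr mulr1 mulNr.
Qed.

Lemma sdp_objective_slack X : sdp_feasible X ->
  4 * sdp_objective w X = #|V|%:R ^+ 2 - \sum_u \sum_v entry X u v
    - \sum_u \sum_v (1 - w u v) * (1 - entry X u v).
Proof.
move=> fX; rewrite sdp_objectiveE // mulVKf ?pnatr_eq0 //.
have -> : #|V|%:R ^+ 2 = \sum_(u : V) \sum_(v : V) (1 : R).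
  by rewrite !sumr_const -natrX -mulrnA mulnn.
rewrite -!sumrB; apply: eq_bigr => u _; rewrite -!sumrB.
by apply: eq_bigr => v _; ring.
Qed.

Lemma sum_entry_ge0 X : sdp_feasible X -> 0 <= \sum_u \sum_v entry X u v.
Proof.
move=> [_ [_ /(_ (const_mx 1))]]; rewrite quad_formE sum_enum_rank.
congr (_ <= _); apply: eq_bigr => u _; rewrite sum_enum_rank.
by apply: eq_bigr => v _; rewrite !mxE mul1r mulr1.
Qed.

Hypothesis w_le1 : forall u v, w u v <= 1.

Lemma slack_ge0 X u v : sdp_feasible X ->
  0 <= (1 - w u v) * (1 - entry X u v).
Proof.
move=> fX; rewrite mulr_ge0 ?subr_ge0 //.
exact: le_trans (ler_norm _) (sdp_feasible_norm_le1 _ _ fX).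
Qed.

Lemma sdp_objective_le X : sdp_feasible X ->
  4 * sdp_objective w X <= #|V|%:R ^+ 2.
Proof.
move=> fX; rewrite sdp_objective_slack // -addrA -opprD gerBl addr_ge0 //.
  exact: sum_entry_ge0.
by apply: sumr_ge0 => u _; apply: sumr_ge0 => v _; apply: slack_ge0.
Qed.

Lemma sdp_optimal_tight X : sdp_feasible X ->
  4 * sdp_objective w X = #|V|%:R ^+ 2 ->
  \sum_u \sum_v entry X u v = 0 /\ forall u v, w u v < 1 -> entry X u v = 1.
Proof.
move=> fX; rewrite sdp_objective_slack // => eqN.
have s_ge0 := sum_entry_ge0 fX.
have row_ge0 u : 0 <= \sum_v (1 - w u v) * (1 - entry X u v).
  by apply: sumr_ge0 => v _; apply: slack_ge0.
have slk_ge0 : 0 <= \sum_u \sum_v (1 - w u v) * (1 - entry X u v).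
  by apply: sumr_ge0.
have slk0 : \sum_u \sum_v (1 - w u v) * (1 - entry X u v) = 0 by lra.
split=> [|u v wuv]; first lra.
have /(_ u isT) row0 := psumr_eq0P (fun u _ => row_ge0 u) slk0.
have /(_ v isT) /eqP := psumr_eq0P (fun v _ => slack_ge0 u v fX) row0.
by rewrite mulf_eq0 !subr_eq0 (gt_eqF wuv) /= => /eqP <-.
Qed.

Definition cut_sign S (u : V) : R := if u \in S then 1 else -1.

Definition cut_mx S : 'M[R]_#|V| :=
  \matrix_(i, j) (cut_sign S (enum_val i) * cut_sign S (enum_val j)).

Lemma entry_cut_mx S u v : entry (cut_mx S) u v = cut_sign S u * cut_sign S v.
Proof. by rewrite /entry mxE !enum_rankK. Qed.

Lemma cut_mx_feasible S : sdp_feasible (cut_mx S).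
Proof.
split=> [i|]; first by rewrite mxE /cut_sign; case: ifP => _; ring.
split=> [|x]; first by apply/matrixP => i j; rewrite !mxE mulrC.
rewrite quad_formE.
have -> : \sum_i \sum_j x i ord0 * cut_mx S i j * x j ord0
          = (\sum_i x i ord0 * cut_sign S (enum_val i)) ^+ 2.
  rewrite expr2 mulr_suml; apply: eq_bigr => i _; rewrite mulr_sumr.
  by apply: eq_bigr => j _; rewrite mxE; ring.
exact: sqr_ge0.
Qed.

Hypothesis w_sym : forall u v, w u v = w v u.

(** An edge contributes [1 - (-1) = 2] exactly when it is cut, and each cut edge
    is met once from either endpoint. *)
Lemma sdp_objective_cut_mx S : sdp_objective w (cut_mx S) = cut_weight w S.
Proof.
rewrite sdp_objectiveE; last exact: cut_mx_feasible.
have sum_out : \sum_(u in ~: S) \sum_(v in S) w u v = cut_weight w S.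
  by rewrite exchange_big; apply: eq_bigr => u _; apply: eq_bigr.
suff -> : \sum_u \sum_v w u v * (1 - entry (cut_mx S) u v)
          = 2 * cut_weight w S + 2 * cut_weight w S by field.
rewrite -{2}sum_out (bigID (mem S)) /=; congr (_ + _); rewrite mulr_sumr.
  apply: eq_bigr => u uS; rewrite (bigID (mem S)) /= big1 => [|v vS].
    rewrite add0r mulr_sumr; apply: eq_big => [v|v vS]; first by rewrite inE.
    by rewrite entry_cut_mx /cut_sign uS (negPf vS); ring.
  by rewrite entry_cut_mx /cut_sign uS vS; ring.
apply: eq_big => [u|u uS]; first by rewrite inE.
rewrite (bigID (mem S)) /= addrC big1 => [|v vS].
  rewrite add0r mulr_sumr; apply: eq_bigr => v vS.
  by rewrite entry_cut_mx /cut_sign (negPf uS) vS; ring.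
by rewrite entry_cut_mx /cut_sign (negPf uS) (negPf vS); ring.
Qed.

Lemma balanced_cut_optimal S : 4 * cut_weight w S = #|V|%:R ^+ 2 ->
  sdp_optimal w (cut_mx S).
Proof.
move=> cutS; split=> [|Y fY]; first exact: cut_mx_feasible.
have := sdp_objective_le fY.
by rewrite -cutS -sdp_objective_cut_mx ler_pM2l ?ltr0n.
Qed.

Lemma balanced_cut_exact S : 4 * cut_weight w S = #|V|%:R ^+ 2 ->
  sdp_value w = maxcut w.
Proof.
move=> /balanced_cut_optimal [_ optS].
have valS T : sdp_values w (cut_weight w T).
  by exists (cut_mx T); [exact: cut_mx_feasible|exact: sdp_objective_cut_mx].
apply/eqP; rewrite eq_le; apply/andP; split.
  apply: ge_sup => [|_ [Y fY <-]]; first by exists (cut_weight w S).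
  apply: le_trans (optS _ fY) _; rewrite sdp_objective_cut_mx /maxcut.
  exact: le_bigmax.
have cut_le T : cut_weight w T <= sdp_value w.
  by apply: ub_le_sup (valS T); case: (has_sup_sdp_values w).
apply: bigmax_le => [|T _]; last exact: cut_le.
by apply: le_trans (cut_le set0); rewrite /cut_weight big_set0.
Qed.

End Objective.

(** * Joins of graphs of equal size *)

Lemma unit_weight_le1 (R : realType) (G : sgraph) (u v : vertex G) :
  unit_weight R u v <= 1.
Proof. by rewrite /unit_weight lern1 leq_b1. Qed.

Lemma unit_weight_sym (R : realType) (G : sgraph) (u v : vertex G) :
  unit_weight R u v = unit_weight R v u.
Proof. by rewrite /unit_weight adj_sym. Qed.

Section Join.
Variables (R : realType) (G1 G2 : sgraph).
Hypothesis card_eq : #|vertex G1| = #|vertex G2|.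

Let J := graph_join G1 G2.
Let w := @unit_weight R J.

Definition left_side : {set vertex (graph_join G1 G2)} :=
  [set x : vertex G1 + vertex G2 | if x is inl _ then true else false].

Lemma left_side_cut : 4 * cut_weight w left_side = #|vertex J|%:R ^+ 2.
Proof.
have -> : cut_weight w left_side = #|vertex G1|%:R * #|vertex G2|%:R.
  rewrite /cut_weight big_sumType /= [X in _ + X]big1 ?addr0; last first.
    by move=> v; rewrite inE.
  rewrite (eq_bigl xpredT) => [|u]; last by rewrite inE.
  rewrite mulr_natl -sumr_const; apply: eq_bigr => u _.
  rewrite big_sumType /= big1 ?add0r => [|v]; last by rewrite !inE.
  by rewrite (eq_bigl xpredT) ?sumr_const // => v; rewrite !inE.
by rewrite card_sum natrD card_eq; ring.
Qed.

Lemma join_exact : sdp_exact R J.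
Proof.
exact: (balanced_cut_exact (@unit_weight_le1 R J) (@unit_weight_sym R J)
  left_side_cut).
Qed.

Lemma join_optimal_unique :
  graph_connected (graph_compl G1) -> graph_connected (graph_compl G2) ->
  exists! X, sdp_optimal w X.
Proof.
move=> conn1 conn2.
have optS := balanced_cut_optimal (@unit_weight_le1 R J) (@unit_weight_sym R J)
  left_side_cut.
exists (cut_mx R left_side); split=> // X [fX optX].
have [diagX [symX _]] := fX.
have objX : 4 * sdp_objective w X = #|vertex J|%:R ^+ 2.
  apply/le_anti/andP; split.
    exact: sdp_objective_le (@unit_weight_le1 R J) _ fX.
  rewrite -left_side_cut -sdp_objective_cut_mx; last exact: unit_weight_sym.
  by rewrite ler_pM2l ?ltr0n //; apply: optX; case: optS.
have [sum0 tight] := sdp_optimal_tight (@unit_weight_le1 R J) fX objX.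
have symE x y : entry X x y = entry X y x by rewrite /entry -[in LHS]symX mxE.
have /card_gt0P[a0 _] := vertex_nonempty G1.
have /card_gt0P[b0 _] := vertex_nonempty G2.
have rowL u v (y : vertex J) : entry X (inl u) y = entry X (inl v) y.
  apply: (connected_row_eq (h := fun u => enum_rank (inl u : vertex J))
    fX conn1).
  move=> a b /andP[_ nab]; apply: tight.
  by rewrite /unit_weight /= (negPf nab) ltr01.
have rowR u v (y : vertex J) : entry X (inr u) y = entry X (inr v) y.
  apply: (connected_row_eq (h := fun u => enum_rank (inr u : vertex J))
    fX conn2).
  move=> a b /andP[_ nab]; apply: tight.
  by rewrite /unit_weight /= (negPf nab) ltr01.
have diag1 (x : vertex J) : entry X x x = 1 by apply: diagX.
pose c := entry X (inl a0) (inr b0).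
have LL u v : entry X (inl u) (inl v) = 1 by rewrite (rowL u v) diag1.
have RR u v : entry X (inr u) (inr v) = 1 by rewrite (rowR u v) diag1.
have LR u v : entry X (inl u) (inr v) = c.
  by rewrite (rowL u a0) symE (rowR v b0) symE.
have RL u v : entry X (inr u) (inl v) = c by rewrite symE LR.
(* Each of the [2 * n] rows of [X] sums to [n * (1 + c)]. *)
have cN1 : c = -1.
  move: sum0; rewrite big_sumType /=.
  rewrite (eq_bigr (fun=> #|vertex G2|%:R * (1 + c))) => [|u _]; last first.
    rewrite big_sumType /=.
    rewrite (eq_bigr _ (fun v _ => LL u v)) (eq_bigr _ (fun v _ => LR u v)).
    by rewrite !sumr_const card_eq -mulr_natl; ring.
  rewrite [X in _ + X](eq_bigr (fun=> #|vertex G2|%:R * (1 + c))); last first.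
    move=> u _; rewrite big_sumType /=.
    rewrite (eq_bigr _ (fun v _ => RL u v)) (eq_bigr _ (fun v _ => RR u v)).
    by rewrite !sumr_const card_eq -mulr_natl; ring.
  rewrite !sumr_const card_eq -mulr2n => /eqP.
  have n0 : #|vertex G2| != 0%N by rewrite -lt0n vertex_nonempty.
  rewrite !mulrn_eq0 (negPf n0) mulf_eq0 pnatr_eq0 (negPf n0) /=.
  by rewrite addrC addr_eq0 => /eqP.
have eqE x y : entry (cut_mx R left_side) x y = entry X x y.
  rewrite entry_cut_mx /cut_sign !inE.
  by case: x y => [u|u] [v|v]; rewrite ?LL ?LR ?RL ?RR ?cN1; ring.
apply/matrixP => i j.
by have := eqE (enum_val i) (enum_val j); rewrite /entry !enum_valK.
Qed.

End Join.

Theorem corollary2 (R : realType) :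
  (forall G1 G2 : sgraph, #|vertex G1| = #|vertex G2| ->
     sdp_exact R (graph_join G1 G2)) /\
  (forall G : sgraph, sdp_exact R (graph_join G G)) /\
  (forall G : sgraph, graph_connected (graph_compl G) ->
     exists! X : 'M[R]_#|vertex (graph_join G G)|,
       sdp_optimal (@unit_weight R (graph_join G G)) X).
Proof.
split; first exact: join_exact.
split=> G; first exact: join_exact.
by move=> connG; apply: join_optimal_unique.
Qed.
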